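(* Let $K$ be a field, $S=K[x_1,\ldots,x_n]$, and let $I\subset S$ be a polymatroidal ideal. Then $I(P)$ is a polymatroidal ideal for all $P\in V^*(I)$.
   Context: A discrete polymatroid on a finite ground set $E$ is a nonempty finite set $\mathcal P\subset \mathbb Z_{\ge 0}^E$ such that: (1) if $u\in\mathcal P$, $v\in\mathbb Z_{\ge0}^E$ and $v\le u$ componentwise, then $v\in\mathcal P$; (2) if $u,v\in\mathcal P$ with $|u|<|v|$ (where $|u|=\sum_i u(i)$), then there is $i$ with $u(i)<v(i)$ and $u+\varepsilon_i\in\mathcal P$, where $\varepsilon_i$ is the $i$th canonical basis vector. Its set of bases $B(\mathcal P)$ consists of the elements of $\mathcal P$ that are maximal with respect to $\le$; they all have the same modulus. Writing $x^u=\prod_i x_i^{u(i)}$, a polymatroidal ideal is a monomial ideal of the polynomial ring in the variables indexed by $E$ whose set of minimal monomial generators is $\{x^u : u\in B(\mathcal P)\}$ for some discrete polymatroid $\mathcal P$ on $E$. $V^*(I)$ is the set of monomial prime ideals (ideals generated by variables) containing $I$. For $P=(x_{i_1},\ldots,x_{i_r})\in V^*(I)$, $I(P)$ is the monomial ideal of $S(P)=K[x_{i_1},\ldots,x_{i_r}]$ obtained from $I$ by the substitution $x_j\mapsto 1$ for all $j\notin\{i_1,\ldots,i_r\}$. *)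

(* Defs.v *)
From HB Require Import structures.
From mathcomp Require Import all_boot all_order all_algebra finmap.
From mathcomp Require Import mpoly.

Set Implicit Arguments.
Unset Strict Implicit.
Unset Printing Implicit Defensive.

Import GRing.Theory.
Local Open Scope ring_scope.

Section DiscretePolymatroids.
Variable n : nat.

(* Vectors of nonnegative integers indexed by 'I_n are the multi-indices
   'X_{1..n}: (u <= v)%MM is the componentwise order, mdeg is the modulus and
   U_(i)%MM is the i-th canonical basis vector. *)
Definition discrete_polymatroid (P : {fset 'X_{1..n}}) : Prop :=
  [/\ exists u, u \in P,
      forall u v : 'X_{1..n}, u \in P -> (v <= u)%MM -> v \in P
    & forall u v : 'X_{1..n}, u \in P -> v \in P -> (mdeg u < mdeg v)%N ->
        exists i : 'I_n, (u i < v i)%N /\ (u + U_(i))%MM \in P].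

Definition polymatroid_base (P : {fset 'X_{1..n}}) (u : 'X_{1..n}) : Prop :=
  u \in P /\ forall v : 'X_{1..n}, v \in P -> (u <= v)%MM -> v = u.

End DiscretePolymatroids.

(* The ideals of ring_quotient are boolean predicates not containing 1; here
   an ideal is an arbitrary, possibly undecidable and possibly improper, one. *)
Definition is_ideal (R : comNzRingType) (I : R -> Prop) : Prop :=
  [/\ I 0, forall a b, I a -> I b -> I (a + b)
    & forall r a, I a -> I (r * a)].

Definition ideal_gen (R : comNzRingType) (G : R -> Prop) (f : R) : Prop :=
  forall J : R -> Prop, is_ideal J -> (forall g, G g -> J g) -> J f.

Section MonomialIdeals.
Variables (K : fieldType) (n : nat).
Implicit Types (I : {mpoly K[n]} -> Prop) (A : {set 'I_n}).

Definition generated_by_monomials I (M : 'X_{1..n} -> Prop) : Prop :=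
  forall f, I f <-> ideal_gen (fun g => exists2 u, M u & g = 'X_[u]) f.

Definition monomial_ideal I : Prop := exists M, generated_by_monomials I M.

Definition minimal_monomial_generators I (M : 'X_{1..n} -> Prop) : Prop :=
  generated_by_monomials I M /\
  forall N : 'X_{1..n} -> Prop, (forall u, N u -> M u) ->
    generated_by_monomials I N -> forall u, M u -> N u.

Definition polymatroidal I : Prop :=
  monomial_ideal I /\
  exists P : {fset 'X_{1..n}},
    discrete_polymatroid P /\ minimal_monomial_generators I (polymatroid_base P).

(* The monomial primes are exactly the ideals monomial_prime A, and A is
   determined by the ideal. *)
Definition monomial_prime A : {mpoly K[n]} -> Prop :=
  ideal_gen (fun g => exists2 i, i \in A & g = 'X_i).

(* A belongs to Vstar I when the prime monomial_prime A contains I. *)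
Definition Vstar I A : Prop := forall f, I f -> monomial_prime A f.

(* For P = monomial_prime A, the ring S(P) = K[x_i : i in A] is
   {mpoly K[#|A|]}, whose variable 'X_j stands for x_(enum_val j). *)
Definition loc_subst A : n.-tuple {mpoly K[#|A|]} :=
  [tuple if [pick j : 'I_#|A| | enum_val j == i] is Some j then 'X_j else 1
    | i < n].

(* I(P) is the image of I under the substitution x_i |-> 1 for i \notin A. This
   substitution is a surjective ring morphism, so that the image of an ideal is
   an ideal. *)
Definition monomial_loc I A (g : {mpoly K[#|A|]}) : Prop :=
  exists2 f, I f & g = f \mPo (loc_subst A).

End MonomialIdeals.

Arguments monomial_loc {K n} I A g.

(* Main.v *)
(* Choose v0 in the polymatroid P, supported outside A and of maximal modulus
   among such vectors. The set of the w in N^A with w + v0 in P is again a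
   discrete polymatroid (the contraction of P), and w is a base of it iff
   w + v0 is a base of P; hence x^w is the image of a generator of I. Conversely,
   for a base u of P, enlarging v0 by entries of u gives a base w + v0 of P with
   w <= u on A, so x^w divides the image of x^u. *)
Require Import Defs.
From HB Require Import structures.
From mathcomp Require Import all_boot all_order all_algebra finmap.
From mathcomp Require Import mpoly.

(** * Bases and iterated exchange in a discrete polymatroid *)

Section Polymatroids.
Set Implicit Arguments.
Unset Strict Implicit.
Unset Printing Implicit Defensive.

Variable n : nat.
Implicit Types (P : {fset 'X_{1..n}}) (u v z : 'X_{1..n}).

Lemma lepm_eq_mdeg u v : (u <= v)%MM -> mdeg v <= mdeg u -> u = v.
Proof.
move=> le_uv le_deg; rewrite -(submK le_uv).
suff /eqP -> : (v - u)%MM == 0%MM by rewrite add0m.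
rewrite -mdeg_eq0 -leqn0 -(leq_add2r (mdeg u)) -mdegD add0n.
by rewrite (submK le_uv).
Qed.

(** Otherwise exchange would add some [U_(i)] to [u] inside [P], against the maximality of [u]. *)
Lemma base_mdeg_max P u v : discrete_polymatroid P ->
  polymatroid_base P u -> v \in P -> mdeg v <= mdeg u.
Proof.
move=> [_ _ exch] [uP umax] vP; rewrite leqNgt; apply/negP=> lt_uv.
have [i [_ uiP]] := exch u v uP vP lt_uv.
have /mnmP/(_ i)/eqP := umax _ uiP (lem_addr _ _).
by rewrite mnmDE mnm1E eqxx addn1 eqn_leq ltnn.
Qed.

Lemma mdeg_max_base P z : z \in P ->
  (forall v, v \in P -> mdeg v <= mdeg z) -> polymatroid_base P z.
Proof.
by move=> zP zmax; split=> // v vP le_zv; rewrite (lepm_eq_mdeg le_zv) ?zmax.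
Qed.

(** Repeated exchange moves [v] towards [u]: each step raises a coordinate where the current vector
    is still below [u], so no coordinate passes the stated maximum. *)
Lemma polymatroid_augment P u v : discrete_polymatroid P ->
  u \in P -> v \in P -> mdeg v <= mdeg u ->
  exists z, [/\ z \in P, (v <= z)%MM, forall i, z i <= maxn (v i) (u i)
              & mdeg z = mdeg u].
Proof.
move=> polyP uP; have [_ _ exch] := polyP.
(* Induction on the gap between the moduli, which each exchange lowers by one. *)
move E: (mdeg u - mdeg v) => k; elim: k v E => [|k IHk] v E vP le_vu.
  exists v; split=> // [|i|]; rewrite ?lepm_refl ?leq_maxl //.
  by apply/eqP; rewrite eqn_leq le_vu -subn_eq0 E.
have lt_vu : mdeg v < mdeg u by rewrite -subn_gt0 E.
have [i [lt_i viP]] := exch v u vP uP lt_vu.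
have deg_vi : mdeg (v + U_(i)) = (mdeg v).+1 by rewrite mdegD mdeg1 addn1.
have [||z [zP le_viz z_max deg_z]] := IHk _ _ viP.
- by rewrite deg_vi subnS E.
- by rewrite deg_vi.
exists z; split=> // [|j]; first exact: lepm_trans (lem_addr _ _) le_viz.
apply: leq_trans (z_max j) _; rewrite mnmDE mnm1E geq_max leq_maxr andbT.
case: eqP => [<-|_]; last by rewrite addn0 leq_maxl.
by rewrite addn1 leq_max lt_i orbT.
Qed.

End Polymatroids.

(** * Ideals generated by monomials *)

Section MonomialIdealGen.
Set Implicit Arguments.
Unset Strict Implicit.
Unset Printing Implicit Defensive.
Import GRing.Theory.
Local Open Scope ring_scope.

Lemma ideal_gen_ideal (R : comNzRingType) (G : R -> Prop) :
  is_ideal (ideal_gen G).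
Proof.
split=> [J [J0 _ _] _ //|a b Ga Gb J J_ideal GJ|r a Ga J J_ideal GJ].
  by have [_ JD _] := J_ideal; apply: JD; [apply: Ga | apply: Gb].
by have [_ _ JM] := J_ideal; apply: JM; apply: Ga.
Qed.

Lemma ideal_gen_sub (R : comNzRingType) (G : R -> Prop) g : G g -> ideal_gen G g.
Proof. by move=> Gg J _ GJ; apply: GJ. Qed.

Variables (K : fieldType) (n : nat).

(** The polynomials whose support consists of multiples of monomials from [M] form an ideal
    containing the generators; it serves as the [J] of [ideal_gen]. *)
Lemma ideal_gen_monomials_dvd (M : 'X_{1..n} -> Prop) (f : {mpoly K[n]}) m :
  ideal_gen (fun g => exists2 u, M u & g = 'X_[u]) f -> m \in msupp f ->
  exists2 u, M u & (u <= m)%MM.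
Proof.
move=> genf; move: m.
apply: (genf (fun f => forall m, m \in msupp f -> exists2 u, M u & (u <= m)%MM)).
  split=> [m|a b Ha Hb m|r a Ha m]; first by rewrite msupp0.
    by move=> /msuppD_le; rewrite mem_cat => /orP[/Ha|/Hb].
  move=> /msuppM_le /allpairsP[[m1 m2] /= [_ /Ha[u Mu le_um2] ->]].
  by exists u => //; apply: lepm_trans le_um2 (lem_addl _ _).
by move=> _ [u Mu ->] m; rewrite msuppX inE => /eqP ->; exists u; rewrite ?lepm_refl.
Qed.

Lemma ideal_gen_monomials_mul (M : 'X_{1..n} -> Prop) u m :
  M u -> (u <= m)%MM ->
  ideal_gen (fun g : {mpoly K[n]} => exists2 u, M u & g = 'X_[u]) 'X_[m].
Proof.
move=> Mu le_um; rewrite -(submK le_um) mpolyXD.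
have [_ _ genM] := @ideal_gen_ideal {mpoly K[n]}
  (fun g => exists2 u, M u & g = 'X_[u]).
by apply: genM; apply: ideal_gen_sub; exists u.
Qed.

(** For [u] in [M], the monomial ['X_[u]] is a multiple of some ['X_[v]] with [v] in [N], hence in
    [M]; the antichain hypothesis forces [v = u]. *)
Lemma antichain_minimal_generators (I : {mpoly K[n]} -> Prop)
    (M : 'X_{1..n} -> Prop) :
    (forall u v, M u -> M v -> (u <= v)%MM -> u = v) ->
  generated_by_monomials I M -> minimal_monomial_generators I M.
Proof.
move=> antiM genM; split=> // N subNM genN u Mu.
have /genM/genN genu := @ideal_gen_sub _
  (fun g : {mpoly K[n]} => exists2 u, M u & g = 'X_[u]) _
  (ex_intro2 _ _ u Mu erefl).
have [|v Nv le_vu] := ideal_gen_monomials_dvd (m := u) genu.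
  by rewrite msuppX inE.
by rewrite -(antiM v u (subNM _ Nv) Mu le_vu).
Qed.

End MonomialIdealGen.

(** * Splitting vectors along [A], and the contraction of a polymatroid *)

Section Localization.
Set Implicit Arguments.
Unset Strict Implicit.
Unset Printing Implicit Defensive.

Variables (n : nat) (A : {set 'I_n}).
Implicit Types (u v : 'X_{1..n}) (w : 'X_{1..#|A|}).

Definition restr u : 'X_{1..#|A|} := [multinom u (enum_val j) | j < #|A|].

(** The [pick] is the one of [loc_subst], so that [pick_enum_val] and [pick_notin] serve both. *)
Definition ext0 w : 'X_{1..n} :=
  [multinom if [pick j : 'I_#|A| | enum_val j == i] is Some j then w j else 0
    | i < n].

(** All [n] coordinates are kept, so that [u] is the sum of [ext0 (restr u)] and [off u]. *)
Definition off u : 'X_{1..n} := [multinom if i \in A then 0 else u i | i < n].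

Lemma pick_enum_val (j : 'I_#|A|) :
  [pick k : 'I_#|A| | enum_val k == enum_val j] = Some j.
Proof.
by case: pickP => [k /eqP/enum_val_inj -> //|/(_ j)]; rewrite eqxx.
Qed.

Lemma pick_notin i : i \notin A ->
  [pick j : 'I_#|A| | enum_val j == i] = None.
Proof.
by move=> /negP iA; case: pickP => // j /eqP ji; case: iA; rewrite -ji enum_valP.
Qed.

Lemma restrE u j : restr u j = u (enum_val j). Proof. exact: mnmE. Qed.

Lemma ext0E w j : ext0 w (enum_val j) = w j.
Proof. by rewrite mnmE pick_enum_val. Qed.

Lemma ext0_notin w i : i \notin A -> ext0 w i = 0.
Proof. by move=> iA; rewrite mnmE pick_notin. Qed.

Lemma off_in u i : i \in A -> off u i = 0.
Proof. by rewrite mnmE => ->. Qed.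

Lemma off_notin u i : i \notin A -> off u i = u i.
Proof. by move=> /negPf iA; rewrite mnmE iA. Qed.

Lemma off_idem u : off (off u) = off u.
Proof. by apply/mnmP=> i; rewrite !mnmE; case: (i \in A). Qed.

Lemma off_le u : (off u <= u)%MM.
Proof. by apply/mnm_lepP=> i; rewrite mnmE; case: ifP. Qed.

Lemma off_lem u v : (u <= v)%MM -> (off u <= off v)%MM.
Proof.
by move/mnm_lepP=> le_uv; apply/mnm_lepP=> i; rewrite !mnmE; case: (i \in A).
Qed.

Lemma restr_ext0D w u : restr (ext0 w + off u) = w.
Proof.
by apply/mnmP=> j; rewrite restrE mnmDE ext0E off_in ?addn0 ?enum_valP.
Qed.

Lemma ext0_restrD u : (ext0 (restr u) + off u)%MM = u.
Proof.
apply/mnmP=> i; rewrite mnmDE; case: (boolP (i \in A)) => iA.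
  by rewrite -(enum_rankK_in iA iA) ext0E restrE off_in ?addn0 ?enum_valP.
by rewrite ext0_notin ?off_notin.
Qed.

Lemma ext0_le w w' : (w <= w')%MM -> (ext0 w <= ext0 w')%MM.
Proof.
by move/mnm_lepP=> le_w; apply/mnm_lepP=> i; rewrite !mnmE; case: pickP.
Qed.

Lemma restr_le u v : (u <= v)%MM -> (restr u <= restr v)%MM.
Proof. by move/mnm_lepP=> le_uv; apply/mnm_lepP=> j; rewrite !restrE. Qed.

Lemma ext0D w w' : ext0 (w + w') = (ext0 w + ext0 w')%MM.
Proof. by apply/mnmP=> i; rewrite !mnmE; case: pickP => // j _; rewrite mnmDE. Qed.

Lemma ext0_U j : ext0 U_(j) = U_(enum_val j)%MM.
Proof.
apply/mnmP=> i; rewrite mnm1E; case: (boolP (i \in A)) => iA.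
  by rewrite -(enum_rankK_in iA iA) ext0E mnm1E (inj_eq enum_val_inj).
rewrite ext0_notin //; case: eqP => // ji.
by move: iA; rewrite -ji enum_valP.
Qed.

Lemma mdeg_ext0 w : mdeg (ext0 w) = mdeg w.
Proof.
rewrite !mdegE (bigID (mem A)) /= [X in _ + X]big1 ?addn0; last first.
  by move=> i; apply: ext0_notin.
by rewrite big_enum_val; apply: eq_bigr => j _; rewrite ext0E.
Qed.

Variables (P : {fset 'X_{1..n}}) (polyP : discrete_polymatroid P).

Lemma exists_max_off :
  exists2 u0, off u0 \in P & forall u, u \in P -> mdeg (off u) <= mdeg (off u0).
Proof.
have [[u uP] down _] := polyP.
have [u0 _ max_u0] := @arg_maxnP P [` uP]%fset xpredT (fun x => mdeg (off (val x))) isT.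
exists (val u0); first exact: down (valP u0) (off_le _).
by move=> v vP; apply: (max_u0 [` vP]%fset).
Qed.

(** The restrictions of elements of [P] supply a finite set to filter; [in_contraction] gives the
    intended membership test. *)
Definition contraction v0 : {fset 'X_{1..#|A|}} :=
  [fset w in [fset restr u | u in P] | (ext0 w + off v0)%MM \in P]%fset.

Lemma in_contraction v0 w :
  (w \in contraction v0) = ((ext0 w + off v0)%MM \in P).
Proof.
rewrite !inE /=; apply: andb_idl => wP.
by apply/imfsetP; exists (ext0 w + off v0)%MM; rewrite ?restr_ext0D.
Qed.

Lemma contraction_polymatroid v0 :
  off v0 \in P -> discrete_polymatroid (contraction v0).
Proof.
have [_ down exch] := polyP; move=> v0P; split.
- exists 0%MM; rewrite in_contraction.
  suff -> : ext0 0%MM = 0%MM by rewrite add0m.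
  by apply/mnmP=> i; rewrite !mnmE; case: pickP => // j _; rewrite mnmE.
- move=> w w'; rewrite !in_contraction => wP le_w; apply: (down _ _ wP).
  by apply/mnm_lepP=> i; rewrite !mnmDE leq_add2r; apply/mnm_lepP/ext0_le.
- move=> w w'; rewrite !in_contraction => wP w'P lt_deg.
  have [|i] := exch _ _ wP w'P; first by rewrite !mdegD ltn_add2r !mdeg_ext0.
  (* Outside [A] both vectors agree with [off v0], so the exchange index lies in [A]. *)
  rewrite !mnmDE ltn_add2r; case: (boolP (i \in A)) => iA; last first.
    by rewrite !ext0_notin // => -[].
  rewrite -(enum_rankK_in iA iA) !ext0E => -[lt_i inP].
  exists (enum_rank_in iA i); split=> //.
  by rewrite in_contraction ext0D ext0_U -addmA [(U_(_) + _)%MM]addmC addmA.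
Qed.

Section Maximal.
Variable v0 : 'X_{1..n}.
Hypothesis v0P : off v0 \in P.
Hypothesis v0max : forall u, u \in P -> mdeg (off u) <= mdeg (off v0).

(** Here [off v0] lies below [off u], whose modulus is no larger by the choice of [v0]. *)
Lemma off_eq u : u \in P -> (off v0 <= u)%MM -> off u = off v0.
Proof.
move=> uP /off_lem; rewrite off_idem => le_u.
by rewrite -(lepm_eq_mdeg le_u) ?v0max.
Qed.

(** By [off_eq], any vector of [P] above [ext0 w + off v0] has the form [ext0 w' + off v0], so
    enlarging in [P] and in the contraction amount to the same. *)
Lemma contraction_base w :
  polymatroid_base (contraction v0) w <->
  polymatroid_base P (ext0 w + off v0)%MM.
Proof.
split=> -[].
  rewrite in_contraction => wP wmax; split=> // v vP le_v.
  have offv := off_eq vP (lepm_trans (lem_addl _ _) le_v).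
  have := wmax (restr v); rewrite in_contraction -offv ext0_restrD => <- //.
    by rewrite ext0_restrD.
  by rewrite -[w](restr_ext0D w v0); apply: restr_le.
move=> wP wmax; split=> [|w']; rewrite in_contraction // => w'P le_w.
rewrite -(restr_ext0D w' v0) (wmax _ w'P) ?restr_ext0D //.
by apply/mnm_lepP=> i; rewrite !mnmDE leq_add2r; apply/mnm_lepP/ext0_le.
Qed.

Lemma contraction_base_le u : polymatroid_base P u ->
  exists2 w, polymatroid_base (contraction v0) w & (w <= restr u)%MM.
Proof.
move=> uB; have max_u := base_mdeg_max polyP uB; have [uP _] := uB.
have [z [zP le_z z_max deg_z]] := polymatroid_augment polyP uP v0P (max_u _ v0P).
(* As [z] lies above [off v0], it equals [ext0 (restr z) + off v0]; it is a base because it has the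
   modulus of [u]. *)
exists (restr z).
  apply/contraction_base; rewrite -(off_eq zP le_z) ext0_restrD.
  by apply: mdeg_max_base => // v vP; rewrite deg_z max_u.
(* On [A] the vector [off v0] vanishes, so the maximum bounding [z] is the entry of [u]. *)
apply/mnm_lepP=> j; rewrite !restrE; apply: leq_trans (z_max _) _.
by rewrite off_in ?enum_valP // max0n.
Qed.

End Maximal.
End Localization.

(** * The substitution and generators of the localized ideal *)

Section Substitution.
Set Implicit Arguments.
Unset Strict Implicit.
Unset Printing Implicit Defensive.
Import GRing.Theory.
Local Open Scope ring_scope.
Variables (K : fieldType) (n : nat) (A : {set 'I_n}).

Lemma loc_subst_enum (j : 'I_#|A|) : tnth (loc_subst K A) (enum_val j) = 'X_j.
Proof. by rewrite tnth_mktuple pick_enum_val. Qed.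

Lemma loc_subst_notin i : i \notin A -> tnth (loc_subst K A) i = 1.
Proof. by move=> iA; rewrite tnth_mktuple pick_notin. Qed.

Lemma loc_substX (u : 'X_{1..n}) : 'X_[u] \mPo loc_subst K A = 'X_[restr A u].
Proof.
rewrite comp_mpolyX (bigID (mem A)) /= [X in _ * X]big1 ?mulr1; last first.
  by move=> i iA; rewrite loc_subst_notin ?expr1n.
rewrite big_enum_val [RHS]mpolyXE_id; apply: eq_bigr => j _.
by rewrite loc_subst_enum restrE.
Qed.

Lemma loc_subst_surj (g : {mpoly K[#|A|]}) :
  exists f : {mpoly K[n]}, f \mPo loc_subst K A = g.
Proof.
exists (\sum_(m <- msupp g) g@_m *: 'X_[ext0 m]).
rewrite raddf_sum [RHS]mpolyE; apply: eq_bigr => m _ /=.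
rewrite comp_mpolyZ loc_substX; congr (_ *: 'X_[_]).
by apply/mnmP=> j; rewrite restrE ext0E.
Qed.

Lemma monomial_loc_ideal (I : {mpoly K[n]} -> Prop) :
  is_ideal I -> is_ideal (monomial_loc I A).
Proof.
move=> [I0 ID IM]; split; first by exists 0; rewrite ?comp_mpoly0.
  move=> _ _ [f If ->] [g Ig ->]; exists (f + g); rewrite ?comp_mpolyD //.
  exact: ID.
(* Surjectivity lifts the multiplier [r] to [{mpoly K[n]}]. *)
move=> r _ [f If ->]; have [s <-] := loc_subst_surj r.
by exists (s * f); [exact: IM | rewrite rmorphM].
Qed.

Lemma comp_mpoly_preideal k l (t : k.-tuple {mpoly K[l]})
    (J : {mpoly K[l]} -> Prop) :
  is_ideal J -> is_ideal (fun f : {mpoly K[k]} => J (f \mPo t)).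
Proof.
move=> [J0 JD JM]; split=> [|a b Ja Jb|r a Ja]; rewrite ?comp_mpoly0 //.
  by rewrite comp_mpolyD; apply: JD.
by rewrite rmorphM; apply: JM.
Qed.

(** Each inclusion is checked on generators: one through the preimage under the substitution of the
    ideal generated by [N], the other through the ideal [monomial_loc I A]. *)
Lemma monomial_loc_generated (I : {mpoly K[n]} -> Prop) M
    (N : 'X_{1..#|A|} -> Prop) : generated_by_monomials I M ->
    (forall u, M u -> exists2 w, N w & (w <= restr A u)%MM) ->
    (forall w, N w -> exists2 u, M u & w = restr A u) ->
  generated_by_monomials (monomial_loc I A) N.
Proof.
move=> genI divN restrN g; split=> [[f /genI genf ->]|geng].
  apply: (genf (fun f => ideal_gen _ (f \mPo loc_subst K A))).
    by apply: comp_mpoly_preideal; apply: ideal_gen_ideal.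
  move=> _ [u /divN[w Nw le_w] ->]; rewrite loc_substX.
  exact: ideal_gen_monomials_mul Nw le_w.
apply: geng => [|_ [w /restrN[u Mu ->] ->]].
  (* [I] is known only through the equivalence [genI], along which the ideal laws are
     transported. *)
  apply: monomial_loc_ideal; have [gen0 genD genM] := @ideal_gen_ideal
    {mpoly K[n]} (fun g => exists2 u, M u & g = 'X_[u]).
  split=> [|a b /genI Ia /genI Ib|r a /genI Ia]; apply/genI => //.
    exact: genD.
  exact: genM.
exists 'X_[u]; last by rewrite loc_substX.
by apply/genI; apply: ideal_gen_sub; exists u.
Qed.

End Substitution.

Theorem corollary2p2 (K : fieldType) (n : nat) (I : {mpoly K[n]} -> Prop)
    (hI : polymatroidal I) (A : {set 'I_n}) (hA : Vstar I A) :
  polymatroidal (monomial_loc I A).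
Proof.
have [_ [P [polyP [genI _]]]] := hI.
have [v0 v0P v0max] := exists_max_off A polyP.
have genQ : generated_by_monomials (monomial_loc I A)
    (polymatroid_base (contraction A P v0)).
  apply: (monomial_loc_generated genI) => [u|w].
    exact: contraction_base_le.
  move/(contraction_base v0max) => wB.
  by exists (ext0 w + off A v0)%MM; rewrite ?restr_ext0D.
split; first by exists (polymatroid_base (contraction A P v0)).
exists (contraction A P v0); split; first exact: contraction_polymatroid.
(* Bases form an antichain, each being maximal. *)
apply: antichain_minimal_generators genQ => u v [_ umax] [vQ _] le_uv.
exact/esym/umax.
Qed.
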